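(* Let $q$ be a prime and let $r\ge 1$ be an integer. Define $$b=\begin{cases} r, & \text{if } q \text{ is odd and } r \text{ is even};\\ r+1, & \text{if } r \text{ is odd};\\ r+2, & \text{if } q=2 \text{ and } r \text{ is even}.\end{cases}$$ Let $e$ be an even (positive) divisor of $b$. Then for every real $\delta\in[0,1]$ there exists a family of $q$-ary linear locally repairable codes with locality $r$, with relative distance $\delta$ and whose rate $R$ satisfies $$R\ge \frac{r}{r+1}-\frac{b}{r+1}\cdot\frac{1}{q^{e/2}-1}-e\delta.$$ That is, there is a sequence $(C_i)_{i\ge1}$ of nonzero $\mathbb{F}_q$-linear codes with locality $r$, where $C_i$ has length $n_i$, dimension $k_i$ and minimum distance $d_i$, such that $n_i\to\infty$, $\liminf_{i\to\infty} d_i/n_i\ge\delta$ and $\liminf_{i\to\infty} k_i/n_i\ge \frac{r}{r+1}-\frac{b}{r+1}\frac{1}{q^{e/2}-1}-e\delta$.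
   Context: Locality: let $C\subseteq\mathbb{F}_q^n$ be a code. For $\alpha\in\mathbb{F}_q$ and $i\in\{1,\dots,n\}$ put $C(i,\alpha)=\{(c_1,\dots,c_n)\in C: c_i=\alpha\}$, and for $I\subseteq\{1,\dots,n\}\setminus\{i\}$ let $C_I(i,\alpha)$ be the projection of $C(i,\alpha)$ on the coordinates in $I$. $C$ is a locally repairable code with locality $r$ if for every $i\in\{1,\dots,n\}$ there is a subset $I_i\subseteq\{1,\dots,n\}\setminus\{i\}$ with $|I_i|\le r$ such that $C_{I_i}(i,\alpha)$ and $C_{I_i}(i,\beta)$ are disjoint for all $\alpha\ne\beta$ in $\mathbb{F}_q$. *)

(* Defs.v *)
From HB Require Import structures.
From mathcomp Require Import all_boot all_order all_algebra.

Set Implicit Arguments.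
Unset Strict Implicit.
Unset Printing Implicit Defensive.

Import GRing.Theory.
Local Open Scope ring_scope.

Section Codes.
Variables (F : finFieldType) (n : nat).

Definition fixed_coord (C : {set 'rV[F]_n}) (i : 'I_n) (a : F)
    : {set 'rV[F]_n} :=
  [set c in C | c ord0 i == a].

Definition proj_word (I : {set 'I_n}) (c : 'rV[F]_n)
    : {ffun {j : 'I_n | j \in I} -> F} :=
  [ffun j => c ord0 (val j)].

Definition proj_code (I : {set 'I_n}) (C : {set 'rV[F]_n})
    : {set {ffun {j : 'I_n | j \in I} -> F}} :=
  [set proj_word I c | c in C].

Definition has_locality (r : nat) (C : {set 'rV[F]_n}) : Prop :=
  forall i : 'I_n, exists I : {set 'I_n},
    [/\ I \subset [set~ i], (#|I| <= r)%N &
      forall a b : F, a != b ->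
        [disjoint proj_code I (fixed_coord C i a)
                & proj_code I (fixed_coord C i b)]].

Definition hamming_dist (x y : 'rV[F]_n) : nat :=
  #|[set j : 'I_n | x ord0 j != y ord0 j]|.

(* Hamming distances are at most n, so the default value n of the minimum is
   only visible for codes with at most one word. *)
Definition min_dist (C : {set 'rV[F]_n}) : nat :=
  \big[minn/n]_(p : 'rV[F]_n * 'rV[F]_n |
      [&& p.1 \in C, p.2 \in C & p.1 != p.2]) hamming_dist p.1 p.2.

Definition codewords (C : {vspace 'rV[F]_n}) : {set 'rV[F]_n} :=
  [set c in C].

End Codes.

(* For q prime, the last case (r even, q even) is the case q = 2. *)
Definition bpar (q r : nat) : nat :=
  if odd r then r.+1 else if odd q then r else r.+2.

(* Main.v *)
(* A Gilbert-Varshamov argument inside the code of length n = m (r + 1) whose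
   m consecutive blocks of r + 1 coordinates each sum to 0: every subcode has
   locality r.  The number of words of weight at most delta n is at most
   q ^ (e delta n) * (1 + (q - 1) / q ^ e) ^ n, so greedily one obtains a
   subcode of relative distance delta and rate at least
   r / (r + 1) - e delta - log_q (1 + (q - 1) / q ^ e), and the logarithm is
   at most (b / (r + 1)) / (q ^ (e / 2) - 1) because b / (r + 1) >= 2 / 3.
   When the required rate is not positive, repetition codes suffice. *)
Require Import Defs.
From HB Require Import structures.
From mathcomp Require Import all_boot all_order all_algebra.
From mathcomp Require Import finfield ring lra.
From mathcomp Require Import all_classical all_reals all_analysis.

Set Implicit Arguments.
Unset Strict Implicit.
Unset Printing Implicit Defensive.

Import Order.TTheory GRing.Theory Num.Theory.
Import numFieldNormedType.Exports.
Local Open Scope classical_set_scope.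
Local Open Scope ring_scope.

(** * Greedy choice of a subspace avoiding a set *)

(* Greedy extension: any vector of A outside the translates V, V + b with b
   in B can be adjoined to V. *)
Lemma exists_avoiding_subspace (F : finFieldType) (n k : nat)
    (A : {vspace 'rV[F]_n}) (B : {pred 'rV[F]_n}) :
    (forall a x, a != 0 -> x \in B -> a *: x \in B) -> 0 \notin B ->
    (#|F| ^ k.-1 * #|B|.+1 < #|F| ^ \dim A)%N ->
  exists2 V : {vspace 'rV[F]_n},
    (V <= A)%VS & \dim V = k /\ forall x, x \in V -> x \notin B.
Proof.
move=> Bscale B0; elim: k => [|k IH] ltA.
  exists 0%VS; first exact: sub0v.
  by rewrite dimv0; split=> // x; rewrite memv0 => /eqP ->.
have [|V VA [dimV VB]] := IH.
  apply: leq_ltn_trans ltA; rewrite leq_mul2r leq_pexp2l ?leq_pred ?orbT //.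
  exact: ltnW (finNzRing_gt1 F).
pose B1 : pred 'rV[F]_n := [predU1 (0 : 'rV[F]_n) & B].
(* [S] is the sum set of [V] and of [B] with 0 adjoined. It has at most |V| (|B| + 1) < |A|
   elements, so [A] contains a vector [v] outside it. *)
pose S := (fun p : 'rV[F]_n * 'rV[F]_n => p.1 + p.2)
  @: [pred p | (p.1 \in V) && (p.2 \in B1)].
have cardS : (#|S| <= #|F| ^ k * #|B|.+1)%N.
  apply: leq_trans (leq_imset_card _ _) _.
  rewrite -dimV -card_vspace -[X in (_ <= _ * X)%N]add1n.
  have -> : #|[pred p : 'rV[F]_n * 'rV[F]_n |
      (p.1 \in V) && (p.2 \in B1)]| = (#|V| * #|B1|)%N.
    by rewrite -cardX; apply: eq_card => -[].
  by rewrite leq_mul2l cardU1 leq_add2r leq_b1 orbT.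
have /fintype.subsetPn[v vA vS] : ~~ (A \subset S).
  apply: contraL ltA => /subset_leq_card; rewrite card_vspace => leAS.
  by rewrite -leqNgt (leq_trans leAS).
have inS u b : u \in V -> b \in B1 -> u + b \in S.
  by move=> uV bB; apply/imsetP; exists (u, b) => //; rewrite inE /= uV.
have vV : v \notin V.
  apply: contra vS => vV; rewrite -[v]addr0; apply: inS => //.
  by rewrite inE eqxx.
exists (V + <[v]>)%VS; first by rewrite subv_add VA -memvE.
split.
  rewrite dimv_disjoint_sum.
    have v0 : v != 0 by apply: contraNneq vV => ->; rewrite mem0v.
    by rewrite dim_vline v0 dimV addn1.
  apply/eqP; rewrite -subv0; apply/subvP => w.
  rewrite memv_cap => /andP[wV /vlineP[a wE]]; move: wV; rewrite wE.
  have [->|a0 avV] := eqVneq a 0; first by rewrite scale0r !mem0v.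
  by rewrite -(scalerK a0 v) memvZ in vV.
move=> _ /memv_addP[u uV [_ /vlineP[a ->] ->]].
have [->|a0] := eqVneq a 0; first by rewrite scale0r addr0 VB.
(* If [u + a *: v] lay in [B], scaling by [a^-1] would put [v] in a translate of [V] by an element
   of [B], hence in [S]. *)
apply: contra vS => /(Bscale a^-1 _ (invr_neq0 a0)) bB.
have -> : v = - (a^-1 *: u) + a^-1 *: (u + a *: v).
  by rewrite scalerDr addKr scalerK.
by apply: inS; rewrite ?memvN ?memvZ // inE /= bB orbT.
Qed.

(** * Weight enumerator and minimum distance *)

(** The summand is a product over the coordinates, each contributing 1 for the symbol 0 and [t] for
    every other symbol. *)
Lemma sum_expr_weight (F : finFieldType) (K : comNzRingType) (n : nat) (t : K) :
  \sum_(x : 'rV[F]_n) t ^+ hamming_dist x 0 = (1 + (#|F|.-1)%:R * t) ^+ n.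
Proof.
transitivity (\prod_(i < n) \sum_(a : F) (if a != 0 then t else 1)).
  rewrite bigA_distr_bigA (reindex (fun f : {ffun 'I_n -> F} => \row_j f j)) /=.
    apply: eq_bigr => f _; rewrite /hamming_dist -prodr_const big_mkcond /=.
    by apply: eq_bigr => j _; rewrite inE !mxE.
  exists (fun x : 'rV_n => [ffun j => x 0 j]) => x _.
    by apply/ffunP => j; rewrite ffunE mxE.
  by apply/rowP => j; rewrite mxE ffunE.
rewrite prodr_const card_ord (bigD1 (0 : F)) //= eqxx /=; congr ((1 + _) ^+ _).
rewrite (eq_bigr (fun=> t)) => [|a ->//].
by rewrite sumr_const mulr_natl cardC1.
Qed.

(** By linearity a distance is the weight of a difference; [t <= n%:R] handles the default value of
    the minimum. *)
Lemma min_dist_ge (R : realType) (F : finFieldType) (n : nat)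
    (C : {vspace 'rV[F]_n}) (t : R) :
    t <= n%:R ->
    (forall x, x \in C -> x != 0 -> t <= (hamming_dist x 0)%:R) ->
  t <= (min_dist (codewords C))%:R.
Proof.
move=> tn tC; rewrite /min_dist; elim/big_ind: _ => //.
  by move=> x y tx ty; rewrite /minn; case: ifP.
move=> [x y] /=; rewrite !inE => /and3P[xC yC xy].
have -> : hamming_dist x y = hamming_dist (x - y) 0.
  by apply: eq_card => j; rewrite !inE !mxE subr_eq0.
by apply: tC; rewrite ?memvB ?subr_eq0.
Qed.

(** * Local parity checks and locality *)

Section LocalParity.
Variables (F : finFieldType) (n m : nat) (g : 'I_n -> 'I_m).

(** Encoded as the kernel of the incidence matrix of the fibres of [g], so that rank-nullity bounds
    its dimension. *)
Definition local_parity_code : {vspace 'rV[F]_n} :=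
  lker (linfun (mulmxr (\matrix_(j < n, l < m) (g j == l)%:R))).

Lemma local_parity_codeP (x : 'rV[F]_n) (l : 'I_m) :
  x \in local_parity_code -> \sum_(j | g j == l) x 0 j = 0.
Proof.
rewrite memv_ker lfunE /= => /eqP/rowP/(_ l); rewrite !mxE; apply: etrans.
rewrite big_mkcond; apply: eq_bigr => j _; rewrite mxE.
by case: eqP; rewrite ?mulr1 ?mulr0.
Qed.

Lemma dim_local_parity_code : (n - m <= \dim local_parity_code)%N.
Proof.
rewrite leq_subLR addnC.
rewrite /local_parity_code; set f := linfun _.
have := limg_ker_dim f fullv; rewrite capfv dimvf dim_matrix mul1r => {1}<-.
rewrite leq_add2l (leq_trans (dimvS (subvf _))) //.
by rewrite dimvf dim_matrix mul1r.
Qed.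

(** If two words agree on the fibre containing [i] except perhaps at [i], their difference sums to 0
    over that fibre, which forces agreement at [i]. *)
Lemma has_locality_sub_parity (r : nat) (C : {vspace 'rV[F]_n}) :
    (forall l, #|[pred j | g j == l]| <= r.+1)%N ->
    (C <= local_parity_code)%VS ->
  has_locality r (codewords C).
Proof.
move=> fibre CA i.
exists (finset [pred j | (j != i) & (g j == g i)]); split.
- by apply/fintype.subsetP => j; rewrite !inE => /andP[].
- rewrite -ltnS (leq_trans _ (fibre (g i))) //.
  rewrite [X in (_ < X)%N](cardD1 i) inE eqxx ltnS.
  by apply: subset_leq_card; apply/fintype.subsetP => j; rewrite !inE.
- move=> a b ab; rewrite disjoint_subset; apply/fintype.subsetP => _ /imsetP[x xC ->].
  rewrite inE; apply/negP => /imsetP[y yC /ffunP xy].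
  move: xC yC; rewrite !inE => /andP[xC /eqP xi] /andP[yC /eqP yi].
  have := local_parity_codeP (g i) (subvP CA _ (memvB xC yC)).
  rewrite (bigD1 i) //= big1 => [|j /andP[gj ji]].
    by rewrite addr0 !mxE xi yi => /eqP; rewrite subr_eq0 (negPf ab).
  have jI : j \in finset [pred j | (j != i) & (g j == g i)].
    by rewrite !inE ji gj.
  by have := xy (exist _ j jI); rewrite !ffunE !mxE /= => ->; rewrite subrr.
Qed.

End LocalParity.

(** * Ball volume and the Gilbert-Varshamov bound inside a subspace *)

(* Chernoff bound: each word of the ball contributes at least 1 to
   [\sum_x T ^ (D - wt x)]. *)
Lemma card_ball_le (R : realType) (F : finFieldType) (n : nat) (D T : R) :
    1 <= T ->
  #|[pred x : 'rV[F]_n | (hamming_dist x 0)%:R <= D]|%:R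
    <= expR (D * ln T) * (1 + (#|F|.-1)%:R * T^-1) ^+ n.
Proof.
move=> T1; have T0 : 0 < T by rewrite (lt_le_trans ltr01).
rewrite -sum_expr_weight mulr_sumr -sum1_card natr_sum.
rewrite [X in X <= _]big_mkcond /=; apply: ler_sum => x _.
rewrite inE; case: ifP => [xD|_].
  have -> : T^-1 = expR (- ln T) by rewrite expRN lnK ?posrE.
  rewrite -expRM_natl -expRD -[1%:R]expR0 ler_expR mulrN -mulrBl.
  by rewrite mulr_ge0 ?subr_ge0 ?ln_ge0.
by rewrite mulr_ge0 ?expR_ge0 // exprn_ge0 // invr_ge0 ltW.
Qed.

(** The set to avoid is the ball without its centre, which is stable under nonzero scalars. The
    centre, in the ball since [0 <= D], accounts for the extra 1 in the greedy count. *)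
Lemma gilbert_varshamov_sub (R : realType) (F : finFieldType) (n k : nat)
    (A : {vspace 'rV[F]_n}) (D : R) : 0 <= D ->
    (#|F| ^ k.-1 * #|[pred x : 'rV[F]_n | ((hamming_dist x 0)%:R <= D)%R]|
       < #|F| ^ \dim A)%N ->
  exists2 V : {vspace 'rV[F]_n}, (V <= A)%VS &
    \dim V = k /\ forall x, x \in V -> x != 0 -> D < (hamming_dist x 0)%:R.
Proof.
move=> D0 ltA.
pose B : pred 'rV[F]_n := [pred x | (x != 0) && ((hamming_dist x 0)%:R <= D)].
have [||| V VA [dimV VB]] := @exists_avoiding_subspace F n k A B.
- move=> a x a0; rewrite !inE scaler_eq0 (negPf a0) /= => /andP[->] /=.
  suff -> : hamming_dist (a *: x) 0 = hamming_dist x 0 by [].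
  by apply: eq_card => j; rewrite !inE !mxE mulf_eq0 (negPf a0).
- by rewrite inE eqxx.
- apply: leq_ltn_trans ltA; rewrite leq_mul2l; apply/orP; right.
  rewrite [X in (_ <= X)%N](cardD1 0) inE.
  have -> : hamming_dist (0 : 'rV[F]_n) 0 = 0%N.
    by apply: eq_card0 => j; rewrite inE eqxx.
  by rewrite D0 add1n.
- exists V => //; split=> // x xV x0.
  by have := VB x xV; rewrite inE x0 /= -ltNge.
Qed.

(** * Real estimates and lower limits *)

(* With [t = sqrt q], [ln q = - 2 ln (1/t) >= 2 (1 - 1/t)], which dominates
   [3/2 (q - 1)/(q + 1)] as [t ^ 2 - 3 t + 4 > 0]. *)
Lemma ln_ge_frac (R : realType) (q : R) : 1 <= q ->
  3 / 2 * ((q - 1) / (q + 1)) <= ln q.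
Proof.
move=> q1; pose t := Num.sqrt q.
have t1 : 1 <= t by rewrite -sqrtr1 ler_wsqrtr.
have t0 : 0 < t by rewrite (lt_le_trans ltr01).
have qE : q = t ^+ 2 by rewrite sqr_sqrtr // (le_trans ler01).
have lnq : 2 * (1 - t^-1) <= ln q.
  have := @le_ln1Dx R (t^-1 - 1); rewrite subrKC.
  rewrite ltrBrDr addNr invr_gt0 => /(_ t0).
  rewrite lnV // qE lnXn // -mulr_natl; lra.
apply: le_trans lnq; rewrite qE.
rewrite -subr_ge0.
have -> : 2 * (1 - t^-1) - 3 / 2 * ((t ^+ 2 - 1) / (t ^+ 2 + 1)) =
    (t - 1) * (t ^+ 2 - 3 * t + 4) / (2 * t * (t ^+ 2 + 1)).
  by field; rewrite ?gt_eqF //; nra.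
by apply: divr_ge0; [apply: mulr_ge0; nra|nra].
Qed.

(** Meant for [s = q ^ (e / 2)] and [c = b / (r + 1)]. Since 2/3 cancels the 3/2 of [ln_ge_frac], (q
    - 1)/(q + 1) <= c ln q; it remains that (s - 1)(q + 1) <= s^2, which follows from q <= s. *)
Lemma ball_exponent_le (R : realType) (q s c : R) :
    1 < q -> q <= s -> 2 / 3 <= c ->
  (q - 1) * (s ^+ 2)^-1 <= c * (1 / (s - 1)) * ln q.
Proof.
move=> q1 qs c23; have lnq := ln_ge_frac (ltW q1).
have s0 : 0 < s - 1 by lra.
have lnc : (q - 1) / (q + 1) <= c * ln q.
  apply: le_trans (_ : 2 / 3 * ln q <= _); first by lra.
  by rewrite ler_wpM2r // ln_ge0 // ltW.
rewrite div1r mulrAC ler_pdivlMr // mulrAC ler_pdivrMr; last by nra.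
apply: le_trans (_ : (q - 1) / (q + 1) * s ^+ 2 <= _); last first.
  by rewrite ler_wpM2r // sqr_ge0.
rewrite mulrAC ler_pdivlMr; last by lra.
rewrite -mulrA ler_wpM2l; [by []|lra|nra].
Qed.

Lemma le_limn_einf (R : realType) (u : nat -> R) (a : R) :
  (forall i, a <= u i) -> (a%:E <= limn_einf (fun i => (u i)%:E))%E.
Proof.
move=> au; rewrite limn_einf_lim; apply: lime_ge; first exact: is_cvg_einfs.
apply: nearW => i; apply: le_ereal_inf_tmp => _ [j _ <-].
by rewrite lee_fin.
Qed.

(** * Block codes and repetition codes *)

Lemma card_divn_fibre (m d k : nat) :
  (0 < d)%N -> (#|[pred j : 'I_(m * d) | j %/ d == k]| <= d)%N.
Proof.
move=> d0; rewrite -[X in (_ <= X)%N]card_ord.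
pose f (j : 'I_(m * d)) : 'I_d := Ordinal (ltn_pmod j d0).
rewrite -(card_in_imset (f := f)) ?max_card // => j l /eqP jk /eqP lk [jl].
by apply: val_inj; rewrite /= (divn_eq j d) (divn_eq l d) jk lk jl.
Qed.

(** The hypothesis [entropy] is a sufficient form of the Gilbert-Varshamov condition: take
    logarithms, divide by the length, and bound 1 + x by exp x. *)
Lemma exists_local_code (R : realType) (F : finFieldType) (r m : nat)
    (rho delta T : R) :
    (0 < m)%N -> 0 < rho -> 0 <= delta -> 1 <= T ->
    delta * ln T + (#|F|.-1)%:R * T^-1
      <= (r%:R / r.+1%:R - rho) * ln (#|F|%:R) ->
  exists C : {vspace 'rV[F]_(m * r.+1)},
    [/\ has_locality r (codewords C),
        rho * (m * r.+1)%:R <= (\dim C)%:R &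
        forall x, x \in C -> x != 0 ->
          delta * (m * r.+1)%:R < (hamming_dist x 0)%:R].
Proof.
move=> m0 rho0 delta0 T1 entropy; set n := (m * r.+1)%N.
set q := #|F|; set L := ln (q%:R : R).
have q1 : (1 < q)%N := finNzRing_gt1 F.
have L0 : 0 < L by rewrite ln_gt0 // ltr1n.
have expL j : (q ^ j)%:R = expR (j%:R * L) :> R.
  by rewrite expRM_natl lnK ?natrX // posrE ltr0n ltnW.
have n0 : 0 < n%:R :> R by rewrite ltr0n muln_gt0 m0.
have g_lt (j : 'I_n) : (j %/ r.+1 < m)%N by rewrite ltn_divLR.
pose g j := Ordinal (g_lt j).
have dimA : (r * m <= \dim (local_parity_code F g))%N.
  by apply: leq_trans (dim_local_parity_code F g); rewrite /n mulnS addKn mulnC.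
(* [k] is the ceiling of rho n. As rho n > 0, [k] is positive and [k.-1] lies strictly below rho n,
   which yields the strict inequality required. *)
have [k [k1 kn nk]] : exists k : nat,
    [/\ (0 < k)%N, k.-1%:R < rho * n%:R & rho * n%:R <= k%:R].
  have rn0 : 0 < rho * n%:R by rewrite mulr_gt0.
  have := Num.Theory.ceil_itv (rho * n%:R).
  case: (Num.ceil _) (ceil_gt0 (rho * n%:R)) => [[|k]|k];
    rewrite rn0 // => _ /andP[lo hi].
  by exists k.+1; split => //; move: lo; rewrite intS addrC addKr.
have [||V VA [dimV wtV]] :=
  @gilbert_varshamov_sub R F n k (local_parity_code F g) (delta * n%:R).
- by rewrite mulr_ge0 // ltW.
- apply: leq_trans (leq_pexp2l (ltnW q1) dimA).
  rewrite -(ltr_nat R) natrM !expL.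
  apply: le_lt_trans (_ : expR (k.-1%:R * L) *
    (expR (delta * n%:R * ln T) * expR (n%:R * ((q.-1)%:R * T^-1))) < _).
    rewrite ler_wpM2l ?expR_ge0 // (le_trans (card_ball_le _ _ _ T1)) //.
    rewrite ler_wpM2l ?expR_ge0 // expRM_natl.
    rewrite lerXn2r ?nnegrE ?expR_ge0 ?expR_ge1Dx // addr_ge0 //.
    by rewrite divr_ge0 // (le_trans ler01).
  rewrite -!expRD ltr_expR.
  have kL : k.-1%:R * L < rho * n%:R * L by rewrite ltr_pM2r.
  have nE : n%:R * (delta * ln T + (q.-1)%:R * T^-1)
      <= n%:R * ((r%:R / r.+1%:R - rho) * L) by rewrite ler_wpM2l // ltW.
  (* This is the lower bound of [dimA] on the dimension of the ambient parity code. *)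
  have rm : n%:R * (r%:R / r.+1%:R) = (r * m)%:R :> R.
    by rewrite /n !natrM -mulrA [r.+1%:R * _]mulrC divfK ?pnatr_eq0 // mulrC.
  by rewrite -rm; move: kL nE; move: T^-1 r.+1%:R^-1 => a b; lra.
exists V; split=> //.
  apply: has_locality_sub_parity VA => l.
  apply: leq_trans (_ : #|[pred j : 'I_n | j %/ r.+1 == l]| <= _)%N.
    by rewrite leq_eqVlt; apply/orP; left; apply/eqP/eq_card => j; rewrite !inE.
  exact: card_divn_fibre.
by rewrite dimV.
Qed.

(** Any one other coordinate determines the symbol at [i]; length at least 2 provides one. *)
Lemma has_locality_repetition (F : finFieldType) (r n : nat) :
  (0 < r)%N -> has_locality r (codewords <[const_mx 1 : 'rV[F]_n.+2]>%VS).
Proof.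
move=> r0 i; exists (finset.set1 (lift i ord0)); split.
- apply/fintype.subsetP => j; rewrite !inE => /eqP ->.
  by rewrite eq_sym neq_lift.
- by rewrite cards1.
move=> a b ab; rewrite disjoint_subset; apply/fintype.subsetP => _ /imsetP[x xC ->].
rewrite inE; apply/negP => /imsetP[y yC /ffunP xy].
have jI : lift i ord0 \in finset.set1 (lift i ord0) by rewrite !inE.
have := xy (exist _ (lift i ord0) jI); rewrite !ffunE /=.
move: xC yC; rewrite !inE => /andP[/vlineP[u ->]]; rewrite !mxE => /eqP ua.
move=> /andP[/vlineP[v ->]]; rewrite !mxE => /eqP vb uv.
by move: ab; rewrite -ua -vb uv eqxx.
Qed.

(** * The parameter b and the asymptotic families *)

(** The extreme case is [r = 2] with [q] odd, where the ratio equals 2/3. *)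
Lemma bpar_ge (R : realFieldType) (q r : nat) :
  (0 < r)%N -> 2 / 3 <= (bpar q r)%:R / r.+1%:R :> R.
Proof.
move=> r0; rewrite ler_pdivlMr ?ltr0n // /bpar.
have r1 : 1 <= r%:R :> R by rewrite ler1n.
case: ifP => [_|]; first by rewrite -[r.+1%:R]natr1; lra.
move=> r_even; have r2 : 2 <= r%:R :> R.
  by rewrite ler_nat; case: r r0 {r1} r_even => [|[]].
by case: ifP => _; rewrite -?[r.+2%:R]natr1 -[r.+1%:R]natr1; lra.
Qed.

Theorem theorem1p4 (R : realType) (q r e : nat) (delta : R)
  (q_prime : prime q) (r_ge1 : (1 <= r)%N)
  (e_gt0 : (0 < e)%N) (e_even : ~~ odd e) (e_dvd : (e %| bpar q r)%N)
  (delta_ge0 : 0 <= delta) (delta_le1 : delta <= 1) :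
  exists (n : nat -> nat) (C : forall i : nat, {vspace 'rV['F_q]_(n i)}),
    [/\ forall i : nat, C i != 0%VS,
        forall i : nat, has_locality r (codewords (C i)),
        n i @[i --> \oo] --> \oo,
        (delta%:E <= limn_einf (fun i : nat =>
          ((min_dist (codewords (C i)))%:R / (n i)%:R : R)%:E))%E &
        ((r%:R / r.+1%:R
           - (bpar q r)%:R / r.+1%:R * (1 / (q%:R ^+ (e./2) - 1))
           - e%:R * delta)%:E
          <= limn_einf (fun i : nat => ((\dim (C i))%:R / (n i)%:R : R)%:E))%E].
Proof.
set rho := _ - e%:R * delta.
have [rho_le0|rho_gt0] := leP rho 0.
  have one_neq0 n : const_mx 1 != 0 :> 'rV['F_q]_n.+2.
    apply/eqP => /rowP/(_ ord0); rewrite !mxE => /eqP.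
    by rewrite oner_eq0.
  (* Relative distance 1 is at least [delta], and a nonnegative rate is at least [rho]. *)
  exists (fun i => i.+2), (fun i => <[const_mx 1]>%VS); split.
  - by move=> i; rewrite -dimv_eq0 dim_vline one_neq0.
  - by move=> i; exact: has_locality_repetition.
  - by under eq_fun do rewrite -addn2; exact: cvg_addnr.
  - apply: le_limn_einf => i; rewrite ler_pdivlMr ?ltr0n //.
    apply: min_dist_ge => [|_ /vlineP[a ->] a0]; first by rewrite ler_piMl.
    rewrite (_ : hamming_dist _ _ = i.+2) ?ler_piMl //.
    rewrite -[RHS]card_ord; apply: eq_card => j; rewrite !inE !mxE mulr1.
    by apply: contraNneq a0 => ->; rewrite scale0r.
  - apply: le_limn_einf => i; apply: le_trans rho_le0 _.
    by rewrite divr_ge0.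
have cardF : #|'F_q| = q := card_Fp q_prime.
have q1 : 1 < q%:R :> R by rewrite ltr1n prime_gt1.
(* With T = q ^ e, [delta * ln T] is e delta ln q, exactly the loss built into [rho];
   [ball_exponent_le] bounds the other term. *)
have entropy : delta * ln (q%:R ^+ e) + (#|'F_q|.-1)%:R * (q%:R ^+ e)^-1
    <= (r%:R / r.+1%:R - rho) * ln (#|'F_q|%:R).
  have eE : q%:R ^+ e = (q%:R ^+ e./2) ^+ 2 :> R.
    by rewrite -exprM muln2 even_halfK.
  rewrite cardF lnXn ?(lt_trans ltr01) // eE.
  (* Being even and positive, [e] satisfies e / 2 >= 1. *)
  have qs : q%:R <= q%:R ^+ e./2 :> R.
    apply: ler_eXnr; last exact: ltW.
    by rewrite half_gt0; case: (e) e_gt0 e_even => [|[]].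
  have := ball_exponent_le q1 qs (bpar_ge R q r_ge1).
  rewrite -subn1 natrB ?prime_gt0 // /rho => ball_le.
  rewrite -[ln _ *+ e]mulr_natl -addrA opprD addNKr opprD !opprK [leRHS]mulrDl.
  by rewrite [leLHS]addrC [delta * _]mulrCA [e%:R * (_ * _)]mulrA lerD2r.
have T1 : 1 <= q%:R ^+ e :> R by rewrite exprn_ege1 // ltW.
have codes i := cid (@exists_local_code R 'F_q r i.+1 rho delta
  (q%:R ^+ e) isT rho_gt0 delta_ge0 T1 entropy).
pose C i := sval (codes i); have C_spec i := svalP (codes i).
have n0 i : 0 < (i.+1 * r.+1)%:R :> R by rewrite ltr0n.
exists (fun i => (i.+1 * r.+1)%N), C; split.
- move=> i; have [_ dimC _] := C_spec i.
  rewrite -dimv_eq0 -lt0n -(ltr_nat R).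
  by rewrite (lt_le_trans _ dimC) // mulr_gt0.
- by move=> i; have [] := C_spec i.
- apply: (cvg_comp (fun i => i.+1) (muln^~ r.+1)); last exact: cvg_mulnr.
  by under eq_fun do rewrite -addn1; exact: cvg_addnr.
- apply: le_limn_einf => i; rewrite ler_pdivlMr //; have [_ _ wtC] := C_spec i.
  apply: min_dist_ge => [|x xC x0]; first by rewrite ler_piMl.
  exact: ltW (wtC x xC x0).
- by apply: le_limn_einf => i; rewrite ler_pdivlMr //; have [] := C_spec i.
Qed.
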